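(* If $\mathfrak{b}=\mathfrak{d}$, then there exists a filter on a countably infinite set that is Menger, has character $\mathfrak{d}$, and is not Hurewicz.
   Context: A filter on a set $D$ is a family $\mathcal{F}\subset\mathcal{P}(D)$ with $\emptyset\notin\mathcal{F}$, closed under intersections of two elements and under supersets in $D$. All filters are assumed to live on a countably infinite set $D$ and to contain all cofinite subsets of $D$. $\mathcal{P}(D)$ carries the Cantor set topology obtained by identifying it with ${}^{D}2$ via characteristic functions, and a filter has the subspace topology. A base of $\mathcal{F}$ is a subset $\mathcal{B}\subset\mathcal{F}$ such that every $x\in\mathcal{F}$ contains some $y\in\mathcal{B}$; the character of $\mathcal{F}$ is the least cardinality of a base of $\mathcal{F}$. A space $X$ is Menger if for every sequence $(\mathcal{U}_n)_{n<\omega}$ of open covers of $X$ there are finite $\mathcal{V}_n\subset\mathcal{U}_n$ such that $\bigcup_{n<\omega}\mathcal{V}_n$ is a cover of $X$. A space $X$ is Hurewicz if for every such sequence there are finite $\mathcal{V}_n\subset\mathcal{U}_n$ such that every $x\in X$ belongs to $\bigcup\mathcal{V}_n$ for all but finitely many $n$. For $f,g\in{}^{\omega}\omega$, $f\leq^\ast g$ means $f(n)\leq g(n)$ for all but finitely many $n$. The cardinal $\mathfrak{b}$ is the least cardinality of a subset of ${}^{\omega}\omega$ with no $\leq^\ast$-upper bound in ${}^{\omega}\omega$; $\mathfrak{d}$ is the least cardinality of a dominating family, i.e. a set $B\subset{}^{\omega}\omega$ such that every $f\in{}^{\omega}\omega$ satisfies $f\leq^\ast g$ for some $g\in B$. 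*)

(* Defs.v *)
From HB Require Import structures.
From mathcomp Require Import all_boot all_order.
From mathcomp Require Import all_classical.
From mathcomp Require Import topology.

Set Implicit Arguments.
Unset Strict Implicit.
Unset Printing Implicit Defensive.

Local Open Scope classical_set_scope.
Local Open Scope card_scope.

(* A cardinal is represented by a set of that cardinality, and equality of
   cardinals is equinumerosity [#=]. The least cardinality of a set satisfying
   P is represented by a set satisfying P that injects into all the others; one
   exists whenever P is satisfiable, see [least_cardP]. *)
Definition least_card (T : Type) (P : set (set T)) : set T :=
  xget set0 [set A | P A /\ forall B, P B -> A #<= B].

Section least_card_exists.
Context {T : Type}.

Lemma least_card_ex (P : set (set T)) :
  P !=set0 -> exists A, P A /\ forall B, P B -> A #<= B.
Proof.
case=> A0 PA0.
(* sets of choice functions for P, pairwise distinct at every A in P *)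
pose Q (S : set (set T -> T)) :=
  (forall s, S s -> forall A, P A -> A (s A)) /\
  (forall s t, S s -> S t -> forall A, P A -> s A = t A -> s = t).
have [|S [[Sch Sinj] Smax]] := @Zorn_bigcup _ Q.
  move=> F FQ Ftot; split=> [s [X FX Xs]|s t [X FX Xs] [Y FY Yt]].
    exact: (FQ _ FX).1 Xs.
  have [XY|YX] := Ftot _ _ FX FY.
    exact: (FQ _ FY).2 (XY _ Xs) Yt.
  exact: (FQ _ FX).2 Xs (YX _ Yt).
have [A [PA Asurj]] :
    exists A, P A /\ forall x, A x -> exists s, S s /\ s A = x.
  apply: contrapT => noA.
  have ex A : exists x, P A -> A x /\ forall s, S s -> s A <> x.
    have [PA|nPA] := pselect (P A); last first.
      have [[x0 _]|T0] := pselect (exists x : T, True); first by exists x0.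
      have A00 : ~ exists x, A0 x by move=> [x _]; apply: T0; exists x.
      by exfalso; apply: noA; exists A0; split=> // x A0x; case: A00; exists x.
    apply: contrapT => nx; apply: noA; exists A; split=> // x Ax.
    apply: contrapT => ns; apply: nx; exists x => _; split=> // s Ss sA.
    by apply: ns; exists s.
  have [u uP] := choice ex.
  apply: (Smax (S `|` [set u])); last first.
    split=> [s [Ss|->]|s t [Ss|->] [St|->] A PA sAtA] //.
    - exact: Sch.
    - by move=> A PA; have [] := uP A PA.
    - exact: Sinj Ss St A PA sAtA.
    - by have [_ /(_ s Ss)] := uP A PA.
    - by have [_ /(_ t St)] := uP A PA; rewrite sAtA.
  split; first exact: subsetUl.
  move=> /(_ u (or_intror erefl)) Su.
  by have [_ /(_ u Su)] := uP A0 PA0.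
exists A; split=> // B PB.
have ex x : exists s, A x -> S s /\ s A = x.
  have [/Asurj [s ?]|] := pselect (A x); first by exists s.
  by exists (fun=> x).
have [g gP] := choice ex.
suff [f] : $|{injfun A >-> B}| by exact: inj_card_le.
apply/injfunPex; exists (fun x => g x B) => [x /gP [Sg _]|x y]; first exact: (Sch _ Sg _ PB).
move=> /set_mem/gP [Sx gx] /set_mem/gP [Sy gy] gxy.
by rewrite -gx -gy (Sinj _ _ Sx Sy B PB gxy).
Qed.

Lemma least_cardP (P : set (set T)) : P !=set0 ->
  P (least_card P) /\ forall B, P B -> least_card P #<= B.
Proof. by move=> /least_card_ex Pex; exact: (xgetPex set0 Pex). Qed.

End least_card_exists.

Definition le_star (f g : nat -> nat) : Prop := \forall n \near \oo, f n <= g n.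

Definition unbounded_family (B : set (nat -> nat)) : Prop :=
  ~ exists g, forall f, B f -> le_star f g.

Definition dominating_family (B : set (nat -> nat)) : Prop :=
  forall f, exists2 g, B g & le_star f g.

Definition bfrak : set (nat -> nat) := least_card unbounded_family.

Definition dfrak : set (nat -> nat) := least_card dominating_family.

Lemma unbounded_familyT : unbounded_family setT.
Proof.
case=> g /(_ (fun n => (g n).+1) I) [N _ /(_ N (leqnn N))] /=.
by rewrite ltnn.
Qed.

Lemma dominating_familyT : dominating_family setT.
Proof. by move=> f; exists f => //; exact: nearW. Qed.

Definition open_cover (X : topologicalType) (U : set (set X)) : Prop :=
  (forall O, U O -> open O) /\ \bigcup_(O in U) O = setT.

Definition menger (X : topologicalType) : Prop :=
  forall U : nat -> set (set X), (forall n, open_cover (U n)) ->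
  exists V : nat -> set (set X),
    (forall n, V n `<=` U n /\ finite_set (V n)) /\
    \bigcup_n \bigcup_(O in V n) O = setT.

Definition hurewicz (X : topologicalType) : Prop :=
  forall U : nat -> set (set X), (forall n, open_cover (U n)) ->
  exists V : nat -> set (set X),
    (forall n, V n `<=` U n /\ finite_set (V n)) /\
    forall x, \forall n \near \oo, (\bigcup_(O in V n) O) x.

Definition is_filter (D : Type) (F : set (set D)) : Prop :=
  ProperFilter F /\ forall A, cofinite_set A -> F A.

(* [set D] is [D -> Prop]; its topology is the one making A |-> (d |-> d \in A)
   a homeomorphism onto the product of copies of the discrete space [bool]. *)
Definition powerset_space (D : Type) : Type := set D.

Definition charfun (D : Type) (A : set D) : prod_topology (fun _ : D => bool) :=
  fun d => d \in A.

HB.instance Definition _ (D : Type) := Choice.copy (powerset_space D) (set D).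
HB.instance Definition _ (D : Type) :=
  Topological.copy (powerset_space D) (initial_topology (@charfun D)).

(* [set_type] carries the subspace topology. *)
Definition filter_space (D : Type) (F : set (set D)) : topologicalType :=
  set_type (F : set (powerset_space D)).

Definition is_base (D : Type) (F B : set (set D)) : Prop :=
  B `<=` F /\ forall A, F A -> exists2 C, B C & C `<=` A.

Definition character (D : Type) (F : set (set D)) : set (set D) :=
  least_card (is_base F).

Lemma is_base_refl (D : Type) (F : set (set D)) : is_base F F.
Proof. by split=> // A FA; exists A. Qed.

(* Main.v *)
Require Import Defs.
From mathcomp Require Import all_boot all_order.
From mathcomp Require Import all_classical.
From mathcomp Require Import topology.
From mathcomp Require Import wochoice zify.

Local Open Scope classical_set_scope.
Local Open Scope card_scope.

(** The filter lives on [nat] and is generated by the complements of the sets in a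
family [X] consisting of all finite sets and of one set [x a] for each index [a]
of a scale [b] of length [bfrak], which is also [dfrak]. Let [U] be a nonprincipal
ultrafilter. The set [x a] is made from [b a] so that for [U]-many [n] it has no
element between [n] and [b a n], and for infinitely many [n] it contains the whole
interval from [n] to [b a n] ([sparse_set]).

The first property puts the complements of the [x a] into [U], so that a proper
filter results, and it makes [X] concentrated on the finite sets: given [g], all
[x a] but those of a set of indices of size less than [bfrak] have, for [U]-many
[n], no element between [n] and [g n]. As [U] is a filter, this extends to finite
unions of the [x a]. The filter is Menger for this reason. A member of it contains
the complement of the union of a finite list from [X]; the supersets of one such
complement form a compact set, so they can be handled by finitely many sets of an
open cover, and those also handle the lists close to the given one. When all sets
of the list have long gaps, their union is close to a finite set, and there are
only finitely many finite sets to consider at each stage. When some set of the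
list lacks these gaps, it is one of fewer than [bfrak] many; it is put aside and
one argues by induction on the length of the list, since fewer than [bfrak]
selections have a common bound ([select_join_size]).

The second property says that the functions sending [k] to the first element of
[Y] after [k], for [Y] in the filter, are unbounded. They depend continuously on
[Y], so the filter is not Hurewicz. They are also bounded by those of the members
of any base, so a base has at least [bfrak] elements. Finally, the finite
intersections of the generators form a base indexed by the finite sequences in an
infinite set of size at most [dfrak], and there are no more of these than
elements of that set ([words_card_le]). *)

(** * Finite sequences over an infinite set *)

(** Among the sets [A] and [B] one has least cardinality. *)
Lemma card_le_total (T : Type) (A B : set T) : A #<= B \/ B #<= A.
Proof.
have [|C [[->|->] Cmin]] := @least_card_ex T [set A; B]; first by exists A; left.
  by left; apply: Cmin; right.
by right; apply: Cmin; left.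
Qed.

Lemma card_le_injP (T : Type) (U : pointedType) (A : set T) (B : set U) :
  A #<= B <-> exists f : T -> U, (forall x, A x -> B (f x)) /\
    (forall x y, A x -> A y -> f x = f y -> x = y).
Proof.
split=> [/pcard_leP/injfunPex [f Af fi]|[f [Af fi]]].
  by exists f; split=> // x y Ax Ay; apply: fi; exact: mem_set.
apply/pcard_leP/injfunPex; exists f => // x y.
by move=> /set_mem + /set_mem; exact: fi.
Qed.

Section seq_card.
Variable T : pointedType.
Implicit Types (A V W : set T) (G : set (seq T * T)) (s : seq T).

Definition words A : set (seq T) := [set s | {subset s <= A}].

(** A relation [G] stands for a partial coding of words by letters: [G (s, x)]
says that [x] is a code of [s]. Words may have several codes, which spares the
extension steps below any choice; the letters in use are those whose one-letter
word has a code. *)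
Let supp G : set T := [set a | exists x, G ([:: a], x)].

Let coding A G :=
  [/\ forall s t x, G (s, x) -> G (t, x) -> s = t,
      forall s, words (supp G) s -> exists x, G (s, x)
    & forall s x, G (s, x) -> [/\ words (supp G) s, supp G x & A x]].

Let in_supp_sub G G' : G `<=` G' -> supp G `<=` supp G'.
Proof. by move=> GG' a [x /GG']; exists x. Qed.

Let words_sub V W s : V `<=` W -> words V s -> words W s.
Proof. by move=> VW sV x /sV; rewrite !inE => /VW. Qed.

Let words_cons A a s : words A (a :: s) -> A a /\ words A s.
Proof.
move=> aA; split=> [|x xs]; first exact/set_mem/aA/mem_head.
by apply: aA; rewrite inE xs orbT.
Qed.

Let coding_bigcup A (F : set (set (seq T * T))) : F !=set0 ->
  (forall G, F G -> coding A G) -> total_on F subset ->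
  coding A (\bigcup_(G in F) G).
Proof.
move=> [G0 FG0] Fc Ftot; split=> [s t x [G FG Gs] [H FH Hs]|s sF|s x [G FG Gs]].
- have [GH|HG] := Ftot _ _ FG FH.
    by have [inj _ _] := Fc _ FH; exact: inj (GH _ Gs) Hs.
  by have [inj _ _] := Fc _ FG; exact: inj Gs (HG _ Hs).
- suff [G FG sG] : exists2 G, F G & words (supp G) s.
    by have [_ /(_ _ sG) [x Gx] _] := Fc _ FG; exists x; exists G.
  elim: s sF => [|a s IH] sF; first by exists G0.
  have [[x [H FH Hx]] /IH [G FG sG]] := words_cons _ _ _ sF.
  have Ha : supp H a by exists x.
  have [GH|HG] := Ftot _ _ FG FH.
    exists H => // y; rewrite !inE => /predU1P[->|/sG/set_mem Gy] //.
    exact: in_supp_sub Gy.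
  exists G => // y; rewrite !inE => /predU1P[->|/sG/set_mem //].
  exact: in_supp_sub Ha.
- have [_ _ /(_ _ _ Gs) [sG xG Ax]] := Fc _ FG.
  have sub : supp G `<=` supp (\bigcup_(G in F) G).
    by apply: in_supp_sub => p Gp; exists G.
  by split=> //; [exact: words_sub sG|exact: sub].
Qed.

(** Once two letters [p] and [q] are available as tags, codes of two-letter
words embed two copies of [supp G] into [supp G]. *)
Let coding_pair A G p q W : coding A G -> supp G p -> supp G q -> p <> q ->
  W #<= supp G -> (forall x, W x -> ~ supp G x) ->
  exists h : T -> T, (forall x, (supp G `|` W) x -> supp G (h x)) /\
    forall x y, (supp G `|` W) x -> (supp G `|` W) y -> h x = h y -> x = y.
Proof.
move=> [inj tot cl] Gp Gq pq /card_le_injP [k [Wk ki]] WG.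
pose t x := if x \in supp G then p else q.
pose v x := if x \in supp G then x else k x.
have tv x : (supp G `|` W) x -> words (supp G) [:: t x; v x].
  move=> xGW y; rewrite !inE /t /v; case: ifPn => [xG|xG].
    by case/orP=> /eqP-> //; rewrite -inE.
  case: xGW => [/mem_set|Wx]; first by rewrite (negPf xG).
  by case/orP=> /eqP-> //; exact: Wk.
have /choice [h hP] : forall x, exists y,
    (supp G `|` W) x -> G ([:: t x; v x], y).
  move=> x; have [/tv/tot [y Gy]|nx] := pselect ((supp G `|` W) x).
    by exists y.
  by exists x.
exists h; split=> [x /hP/cl []//|x y /[dup] xGW /hP Gx /[dup] yGW /hP Gy hxy].
move: Gx; rewrite hxy => /inj /(_ Gy) []; rewrite /t /v.
case: ifPn => [xG|/negP xG]; case: ifPn => [yG|/negP yG] //.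
- by move=> qp; have := pq (esym qp).
- have W' z : ~ (z \in supp G) -> (supp G `|` W) z -> W z.
    by move=> zG [/mem_set|].
  by move=> _; apply: ki; exact: W'.
Qed.

(** Zorn's lemma gives a maximal coding [G] among those extending the coding of
words over a copy of [nat] inside [A]. If [A] minus [supp G] embeds into [supp G],
then so does [A], by [coding_pair], and [G] codes the words over [A]. Otherwise
[supp G] has a copy [W] in [A] outside itself, and the words over the union of
[supp G] and [W] can be coded by the elements of [W], against maximality. *)
Lemma words_card_le A : infinite_set A -> words A #<= A.
Proof.
move=> /infiniteP/card_le_injP [i [iA ii]].
have {}ii : injective i by move=> m n; exact: ii.
have {}iA n : A (i n) by exact: iA.
pose G0 : set (seq T * T) := range (fun l => (map i l, i (pickle l))).
have G0P n : supp G0 (i n) by exists (i (pickle [:: n])); exists [:: n].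
have cG0 : coding A G0.
  split=> [s t x [l _ [<- <-]] [m _ [<-]]|s|s _ [l _ [<- <-]]].
  - by move/ii/(pcan_inj pickleK)->.
  - move=> sG; suff [l <-] : exists l, map i l = s.
      by exists (i (pickle l)); exists l.
    elim: s sG => [|a s IH] sG; first by exists [::].
    have [[x [[|n [|? ?]] // _ [<- _]]] /IH [l <-]] := words_cons _ _ _ sG.
    by exists (n :: l).
  - by split=> // x /mapP[n _ ->]; rewrite inE.
(* adding [G0] to every member makes the empty chain harmless *)
have [F Fc Ftot|M [Mc Mmax]] := @Zorn_bigcup _ [set G | coding A (G `|` G0)].
  have [F0|/nonemptyPn F0] := pselect (F !=set0); last first.
    by rewrite /= F0 bigcup_set0 set0U.
  rewrite /mkset.
  have -> : \bigcup_(G in F) G `|` G0 =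
      \bigcup_(H in [set G `|` G0 | G in F]) H.
    rewrite bigcup_image; apply/seteqP; split=> x.
      move=> [[G FG Gx]|G0x]; first by exists G => //; left.
      by have [G FG] := F0; exists G => //; right.
    by move=> [G FG [Gx|]]; [left; exists G|right].
  apply: coding_bigcup.
  - by have [G FG] := F0; exists (G `|` G0); exists G.
  - by move=> _ [G FG <-]; exact: Fc.
  - move=> _ _ [G FG <-] [H FH <-].
    by have [GH|HG] := Ftot _ _ FG FH; [left|right]; exact: setSU.
set G := M `|` G0 in Mc.
have {}Mmax H : G `<=` H -> coding A H -> H `<=` G.
  move=> GH Hc x Hx; left; apply: contrapT => nMx.
  apply: (Mmax H); last first.
    by rewrite /= setUidl // => y G0y; apply: GH; right.
  by split=> [y My|/(_ x Hx)//]; apply: GH; left.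
have Gp : supp G (i 0) by apply: in_supp_sub (G0P 0) => y; right.
have Gq : supp G (i 1) by apply: in_supp_sub (G0P 1) => y; right.
have pq : i 0 <> i 1 by move/ii.
have [inj tot cl] := Mc.
have map_code (B : set T) (h : T -> T) : (forall x, B x -> supp G (h x)) ->
    (forall x y, B x -> B y -> h x = h y -> x = y) ->
    (forall s, words B s -> exists x, G (map h s, x)) /\
    (forall s t, words B s -> words B t -> map h s = map h t -> s = t).
  move=> hB hi; split=> [s sB|].
    by apply: tot => x /mapP[y /sB/set_mem/hB ? ->]; exact: mem_set.
  elim=> [|a s IH] [|b t] //= /words_cons [Ba sB] /words_cons [Bb tB] [hab hst].
  by rewrite (hi a b) // (IH t).
have [le|le] := card_le_total T (A `\` supp G) (supp G).
  have [h [hG hi]] := coding_pair A G _ _ (A `\` supp G) Mc Gp Gq pq le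
    (fun x Wx => proj2 Wx).
  have AU x : A x -> (supp G `|` A `\` supp G) x.
    by move=> Ax; have [|] := pselect (supp G x); [left|right].
  have [hex hinj] := map_code A h (fun x Ax => hG x (AU x Ax))
    (fun x y Ax Ay => hi x y (AU x Ax) (AU y Ay)).
  have /choice [c cP] : forall s, exists x, words A s -> G (map h s, x).
    move=> s; have [/hex [x Gx]|ns] := pselect (words A s); first by exists x.
    by exists (i 0).
  apply/card_le_injP; exists c; split=> [s /cP/cl[]//|s t sA tA cst].
  by apply: hinj => //; apply: inj (cP _ sA) _; rewrite cst; exact: cP.
have /card_le_injP [j [jA ji]] := le.
pose W := j @` supp G.
have WG x : W x -> ~ supp G x by move=> [y /jA[_ + <-]].
have [h [hG hi]] := coding_pair A G _ _ W Mc Gp Gq pq (card_image_le _ _) WG.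
have [hex hinj] := map_code _ h hG hi.
pose N := [set p | exists x, [/\ words (supp G `|` W) p.1,
  ~ words (supp G) p.1, G (map h p.1, x) & p.2 = j x]].
have GGN : G `<=` G `|` N by move=> ?; left.
have suppE x : (supp G `|` W) x -> supp (G `|` N) x.
  move=> xGW; have [xG|xG] := pselect (supp G x).
    exact: in_supp_sub xG.
  have xW : words (supp G `|` W) [:: x].
    by move=> z; rewrite mem_seq1 => /eqP->; exact: mem_set.
  have [y Gy] := hex _ xW; exists (j y); right; exists y; split=> //.
  by move=> /(_ x (mem_head _ _))/set_mem.
have suppI x : supp (G `|` N) x -> (supp G `|` W) x.
  move=> [y [Gy|[z [/(_ x (mem_head _ _))/set_mem//]]]].
  by left; exists y.
suff /(Mmax _ GGN) NG : coding A (G `|` N).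
  have W0 : W (j (i 0)) by exists (i 0).
  by case: (WG _ W0); apply: in_supp_sub NG _ _; apply: suppE; right.
split=> [s t x|s sGN|s x].
- move=> [Gs|[y [sW sG Gy /= ->]]] [Gt|[z [tW tG Gz /= xz]]].
  + exact: inj Gs Gt.
  + have [_ + _] := cl _ _ Gs => /WG[]; rewrite xz; exists z => //.
    by have [_ + _] := cl _ _ Gz.
  + have [_ + _] := cl _ _ Gt => /WG[]; exists y => //.
    by have [_ + _] := cl _ _ Gy.
  + apply: hinj => //; apply: (inj _ _ _ Gy); rewrite (ji y z) //.
    * by have [_ + _] := cl _ _ Gy.
    * by have [_ + _] := cl _ _ Gz.
- have [/tot [x Gx]|sG] := pselect (words (supp G) s); first by exists x; left.
  have sW : words (supp G `|` W) s by apply: words_sub sGN.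
  by have [x Gx] := hex _ sW; exists (j x); right; exists x.
- move=> [/cl [sG xG Ax]|[y [/= sW _ /cl[_ yG _] ->]]].
    have sub := in_supp_sub _ _ GGN.
    by split=> //; [exact: words_sub sG|exact: sub].
  split; [exact: words_sub suppE sW| |exact: (jA _ yG).1].
  by apply: suppE; right; exists y.
Qed.
End seq_card.

Arguments words {T} A.

(** * Bounded families and scales *)

Lemma le_starP (f g : nat -> nat) :
  le_star f g <-> exists N, forall n, N <= n -> f n <= g n.
Proof. by split=> [[N _ fg]|[N fg]]; exists N. Qed.

Lemma le_star_trans f g h : le_star f g -> le_star g h -> le_star f h.
Proof.
move=> /le_starP [N fg] /le_starP [M gh]; apply/le_starP; exists (N + M) => n nM.
by apply: leq_trans (fg n _) (gh n _); lia.
Qed.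

Lemma le_star_bound (f : nat -> nat -> nat) : exists g, forall i, le_star (f i) g.
Proof.
exists (fun n => \max_(i < n.+1) f i n) => i; apply/le_starP; exists i => n le_in.
by rewrite -ltnS in le_in; exact: (leq_bigmax (Ordinal le_in)).
Qed.

Lemma le_star_bound2 f g : exists h, le_star f h /\ le_star g h.
Proof.
have [h hP] := le_star_bound (fun i => if i is 0 then f else g).
by exists h; split; [exact: (hP 0)|exact: (hP 1)].
Qed.

(** For index sets this is the property of having cardinality below [bfrak] in
the form in which it is used; [bfrak_le] gives the link. *)
Definition small {T : Type} (S : set T) : Prop :=
  forall p : T -> nat -> nat, exists g, forall s, S s -> le_star (p s) g.

Lemma small_sub (T : Type) (A B : set T) : A `<=` B -> small B -> small A.
Proof. by move=> AB sB p; have [g gP] := sB p; exists g => s /AB; exact: gP. Qed.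

Lemma smallU (T : Type) (A B : set T) : small A -> small B -> small (A `|` B).
Proof.
move=> sA sB p; have [g gA] := sA p; have [h hB] := sB p.
have [k [gk hk]] := le_star_bound2 g h.
exists k => s [/gA|/hB] /le_star_trans; exact.
Qed.

Lemma small_image (T U : Type) (f : T -> U) (A : set T) :
  small A -> small (f @` A).
Proof.
by move=> sA p; have [g gP] := sA (p \o f); exists g => _ [a /gP ? <-].
Qed.

Lemma countable_small (T : Type) (A : set T) : countable A -> small A.
Proof.
have [->|/set0P [x _]] := eqVneq A set0.
  by move=> _ p; exists id => ? [].
move=> /pfcard_geP [->|/surjfunPex [e ->]] p; first by exists id.
have [g gP] := le_star_bound (fun i => p (e i)).
by exists g => _ [i _ <-]; exact: gP.
Qed.

Lemma bfrak_le (T : Type) (A : set T) : ~ small A -> bfrak #<= A.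
Proof.
move=> /existsNP [p pA].
have pu : unbounded_family (p @` A).
  by move=> [g gP]; apply: pA; exists g => s As; apply: gP; exists s.
have [_ /(_ _ pu)] := least_cardP (ex_intro _ _ pu).
by move=> /card_le_trans; apply; exact: card_image_le.
Qed.

Lemma dfrak_dominating : dominating_family dfrak.
Proof. by have [] := least_cardP (ex_intro _ _ dominating_familyT). Qed.

Lemma dfrak_not_small : ~ small dfrak.
Proof.
move=> /(_ id) [g gP]; have [h dh gh] := dfrak_dominating (fun n => (g n).+1).
have /le_starP [N /(_ N (leqnn N))] := le_star_trans _ _ _ gh (gP _ dh).
by rewrite ltnn.
Qed.

(** A scale. Well-order a dominating family of size [dfrak] and let [I] be its
shortest initial segment that is not small; as [bfrak #= dfrak], [I] maps onto
[dfrak] by some [e]. Proper initial segments of [I] are small, so [b a] can be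
taken above all [e c] with [c] at most [a]. If [e c] dominates [g], then so does
[b a] for every [a] from [c] on. *)
Lemma scale_of_eq : bfrak #= dfrak ->
  exists (I : set (nat -> nat)) (b : (nat -> nat) -> nat -> nat),
  [/\ ~ small I, I #<= dfrak &
      forall g, small [set a | I a /\ ~ le_star g (b a)]].
Proof.
move=> bd.
have [R wo] := well_ordering_principle (nat -> nat).
have wmin (A : set (nat -> nat)) : A !=set0 ->
    exists2 z, A z & forall x, A x -> R z x.
  move=> [x Ax]; have [|z [[/asboolP Az zP] _]] := wo (fun x => `[< A x >]).
    by exists x; exact/asboolP.
  by exists z => // y Ay; apply: zP; exact/asboolP.
have Rtot x y : R x y \/ R y x.
  have [|z [->|->] zP] := wmin [set x; y]; first by exists x; left.
    by left; apply: zP; right.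
  by right; apply: zP; left.
pose below A a : set (nat -> nat) := [set x | [/\ A x, R x a & x <> a]].
have [I [Id nI Ib]] : exists I, [/\ I `<=` dfrak, ~ small I &
    forall a, I a -> small (below I a)].
  have [[a na]|nex] := pselect (exists a, ~ small (below dfrak a)); last first.
    exists dfrak; split=> // [|a _]; first exact: dfrak_not_small.
    by apply: contrapT => na; apply: nex; exists a.
  have [|z nz zmin] := wmin [set a | ~ small (below dfrak a)]; first by exists a.
  exists (below dfrak z); split=> // [x []//|c [dc Rcz cz]].
  apply: contrapT => nc; apply: cz.
  have /zmin Rzc : ~ small (below dfrak c).
    by move=> sc; apply: nc; apply: small_sub sc => x [[]].
  have [|w [_ wu]] := wo (fun x => `[< x = c \/ x = z >]).
    by exists c; apply/asboolP; left.
  have Rxx x : R x x by have [] := Rtot x x.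
  rewrite -(wu c) ?(wu z) //; split=> [|x /asboolP[->|->]//]; apply/asboolP.
    by right.
  by left.
have Il a : I a -> small [set x | I x /\ R x a].
  move=> /Ib sa; apply: (@small_sub _ _ (below I a `|` [set a])).
    by move=> x [Ix Rx]; have [->|xa] := pselect (x = a); [right|left].
  by apply: smallU => //; apply: countable_small; exact: countable1.
have /pcard_surjP [e eP] : dfrak #<= I.
  by rewrite -(card_le_eql bd); exact: bfrak_le.
have /choice [b bP] : forall a, exists b, I a ->
    forall x, I x -> R x a -> le_star (e x) b.
  move=> a; have [/Il/(_ e) [b bP]|na] := pselect (I a); last by exists id.
  by exists b => _ x Ix Rx; exact: bP.
exists I, b; split=> // [|g]; first exact: subset_card_le.
have [f /eP [c Ic <-] gc] := dfrak_dominating g.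
apply: small_sub (Il c Ic) => a [Ia nga]; split=> //.
have [//|Rca] := Rtot a c; case: nga; apply: le_star_trans gc _.
exact: bP.
Qed.

Lemma block_index (h : nat -> nat) : h 0 = 0 -> (forall k, h k < h k.+1) ->
  forall n, exists k, h k <= n < h k.+1.
Proof.
move=> h0 hS; elim=> [|n [k /andP[kn nk]]].
  by exists 0; have := hS 0; rewrite h0.
have [nk'|] := ltnP n.+1 (h k.+1); first by exists k; rewrite nk' ltnW.
by move=> kn'; exists k.+1; have := hS k.+1; lia.
Qed.

(** Cut [nat] into blocks [h k, h k.+1) so long that [f n] never lies further than
in the block after that of [n]. The ultrafilter selects the residue [r] modulo 3
of the index of the block of [n]. The union of the blocks of residue [r + 2] then
has a gap from [n] to [f n] for almost all [n] in the sense of [U], since the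
residues of the blocks met are [r] and [r + 1], and it contains arbitrarily late
intervals from [n] to [f n], [n] being the left end of a block. *)
Lemma sparse_set (U : set_system nat) (f : nat -> nat) : UltraFilter U ->
  exists x : nat -> bool,
    U [set n | forall j, n <= j <= maxn n (f n) -> ~~ x j] /\
    forall K, exists2 n, K <= n & forall j, n <= j <= f n -> x j.
Proof.
move=> UU.
pose g n := (n + \max_(i < n.+1) f i).+1.
have gf n : f n < g n.
  by have := leq_bigmax (F := fun i : 'I_n.+1 => f i) ord_max; rewrite /g /=; lia.
have gn n : n < g n by rewrite /g; lia.
have gmono m n : m <= n -> g m <= g n.
  move=> mn; rewrite /g ltnS leq_add //; apply/bigmax_leqP => i _.
  have i_n : i < n.+1 by rewrite (leq_trans (ltn_ord i)).
  exact: (leq_bigmax (Ordinal i_n)).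
pose h k := iter k g 0.
have hS k : h k < h k.+1 by exact: gn.
have hmono k l : k <= l -> h k <= h l.
  move=> /subnK <-; elim: (l - k) => // i IH.
  by apply: leq_trans IH _; exact: ltnW.
have [idx idxP] := choice (block_index h erefl hS).
have hk k : k <= h k by elim: k => // k IH; exact: leq_ltn_trans IH (hS k).
have idx_mono k l : h k <= l -> l < h k.+1 -> idx l = k.
  move=> kl lk; have /andP[il li] := idxP l; apply/eqP; rewrite eqn_leq.
  apply/andP; split; rewrite leqNgt; apply/negP => /hmono; lia.
have [r rU] : exists r, U [set n | idx n %% 3 = r].
  have [U0|U0] := in_ultra_setVsetC [set n | idx n %% 3 = 0] UU.
    by exists 0.
  have [U1|U1] := in_ultra_setVsetC [set n | idx n %% 3 = 1] UU.
    by exists 1.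
  exists 2; apply: filterS (filterI U0 U1) => n [/= n0 n1].
  by have := ltn_pmod (idx n) (isT : 0 < 3); lia.
exists (fun n => idx n %% 3 == (r + 2) %% 3); split.
  apply: filterS rU => n /= nr j /andP[nj jn].
  have /andP[kn nk] := idxP n; set k := idx n in nr kn nk.
  have jk : j < h k.+2.
    have : g n <= h k.+2 by apply: gmono; exact: ltnW.
    by have := gf n; have := gn n; lia.
  have [jk1|jk1] := ltnP j (h k.+1).
    by rewrite (idx_mono k) //; lia.
  by rewrite (idx_mono k.+1) //; lia.
move=> K; exists (h (K * 3 + r + 2)); first by apply: leq_trans (hk _); lia.
move=> j /andP[kj jk]; rewrite (idx_mono (K * 3 + r + 2)) //.
  by rewrite -addnA modnMDl.
exact: leq_ltn_trans jk (gf _).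
Qed.

(** * Selections for finite unions *)

Definition join (l : seq (nat -> bool)) : nat -> bool :=
  fun i => has (fun z => z i) l.

Definition agree (m : nat) (f g : nat -> bool) := forall i, i < m -> f i = g i.

Definition gap (g : nat -> nat) (z : nat -> bool) : set nat :=
  [set n | forall j, n <= j <= g n -> ~~ z j].

Section selection.
Variables (U : set_system nat) (X : set (nat -> bool)).
Hypothesis UF : ProperFilter U.
Hypothesis Uoo : \oo `<=` U.
Hypothesis Xfin : forall z N, (forall j, N <= j -> ~~ z j) -> X z.
Hypothesis Xgap : forall g, small [set z | X z /\ ~ U (gap g z)].

(** [G k m z] is to be read: from the [k]-th cover one can choose finitely many
sets that take care of everything attached to the points of the Cantor space
that agree with [z] below [m]. *)
Definition local (G : nat -> nat -> (nat -> bool) -> Prop) :=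
  forall k m z z', agree m z z' -> G k m z -> G k m z'.

Definition selects G (g : nat -> nat) (l : seq (nat -> bool)) :=
  forall K, exists k m, [/\ K <= k, m <= g k & G k m (join l)].

Lemma selects_le_star G f g l : le_star f g -> selects G f l -> selects G g l.
Proof.
move=> /le_starP [N fg] Gf K; have [k [m [Kk mk Gm]]] := Gf (K + N).
by exists k, m; split=> //; [lia|apply: leq_trans mk (fg _ _); lia].
Qed.

Lemma gap_join g l : (forall z, z \in l -> U (gap g z)) -> U (gap g (join l)).
Proof.
elim: l => [|z l IH] lU; first by apply: filterS filterT => n _ j _.
have Ul : U (gap g (join l)).
  by apply: IH => y yl; apply: lU; rewrite in_cons yl orbT.
apply: filterS (filterI (lU z (mem_head _ _)) Ul) => n [/= zn ln] j nj.
by rewrite /join /= negb_or zn //; exact: ln.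
Qed.

(** There are only finitely many subsets of [k], so some [g k] bounds the [m] that
they need at stage [k]. If [z] has no element from [k] to [g k], then below [g k]
it agrees with its trace on [k], and [G] holds for [z] as for this finite set. *)
Lemma select_gap G : local G -> (forall k z, X z -> exists m, G k m z) ->
  exists g, forall z, U (gap g z) ->
    forall K, exists k m, [/\ K <= k, m <= g k & G k m z].
Proof.
move=> Gloc Gcov.
pose ext k (q : k.-tuple bool) j := nth false q j.
have /choice [m mP] : forall p : {k : nat & k.-tuple bool},
    exists m, G (projT1 p) m (ext _ (projT2 p)).
  move=> [k q] /=; apply: Gcov; apply: (Xfin _ k) => j kj.
  by rewrite /ext nth_default // size_tuple.
pose g k := k + \max_(q : k.-tuple bool) m (existT _ k q).
exists g => z Uz K.
have [k [/= zk Kk]] : exists k, (gap g z `&` [set n | K <= n]) k.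
  by apply: (@filter_ex _ U); apply: (filterI Uz); apply: Uoo; exists K.
pose q := [tuple z i | i < k].
exists k, (m (existT _ k q)).
have mg : m (existT _ k q) <= g k.
  rewrite /g (leq_trans _ (leq_addl _ _)) //.
  by rewrite (leq_bigmax (F := fun q : k.-tuple bool => m (existT _ k q))).
split=> //; apply: Gloc (mP (existT _ k q)) => i im /=.
rewrite /ext; have [ik|ki] := ltnP i k.
  by rewrite (nth_map (Ordinal ik)) ?size_enum_ord // nth_enum_ord.
rewrite nth_default ?size_tuple //.
by apply/esym/negbTE/zk; rewrite ki (leq_trans (ltnW im)).
Qed.

(** Induction on [n]. The [g0] of [select_gap] serves all lists whose members have
[U]-many gaps for [g0], because then the union has such gaps. Any other list has
a member [s] in a small set; for each such [s] the induction hypothesis, applied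
to the sets [s || z], provides a selection for the rest of the list, and the
selections obtained for a small set of [s] have a common bound. *)
Lemma select_join_size n G : local G ->
  (forall k l, words X l -> exists m, G k m (join l)) ->
  exists g, forall l, words X l -> size l <= n -> selects G g l.
Proof.
elim: n G => [|n IH] G Gloc Gcov.
  have /choice [g gP] : forall k, exists m, G k m (join [::]).
    by move=> k; apply: Gcov.
  by exists g => -[|//] _ _ K; exists K, (g K).
have [|g0 g0P] := @select_gap G Gloc.
  move=> k z Xz; have [|m Gm] := Gcov k [:: z].
    by move=> y; rewrite mem_seq1 => /eqP->; exact: mem_set.
  by exists m; apply: Gloc Gm => i _; rewrite /join /= orbF.
pose Gs (s : nat -> bool) k m z := G k m (fun i => s i || z i).
have /choice [f fP] : forall s, exists g, X s ->
    forall l, words X l -> size l <= n -> selects (Gs s) g l.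
  move=> s; have [Xs|nXs] := pselect (X s); last by exists id.
  have [||g gP] := IH (Gs s); last by exists g.
    by move=> k m z z' zz'; apply: Gloc => i /zz' ->.
  move=> k l lX; apply: (Gcov k (s :: l)) => y.
  by rewrite in_cons => /predU1P[->|/lX//]; exact: mem_set.
have [g1 g1P] := Xgap g0 f.
have [g [g0g g1g]] := le_star_bound2 g0 g1.
exists g => l lX ln.
have [lU|] := pselect (forall z, z \in l -> U (gap g0 z)).
  apply: selects_le_star g0g _ => K; exact: g0P (gap_join _ _ lU) K.
move=> /existsNP [s /not_implyP [sl nUs]].
have Xs : X s by exact/set_mem/lX.
have fg : le_star (f s) g by apply: le_star_trans (g1P s _) g1g.
apply: selects_le_star fg _ => K.
have [||k [m [Kk mf Gm]]] := fP s Xs (rem s l) _ _ K.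
- by move=> y /mem_rem/lX.
- by rewrite size_rem //; case: (size l) ln.
exists k, m; split=> //; apply: Gloc Gm => i _.
by rewrite [in RHS]/join (perm_has (fun z => z i) (perm_to_rem sl)).
Qed.

Lemma select_join G : local G ->
  (forall k l, words X l -> exists m, G k m (join l)) ->
  exists g, forall l, words X l -> selects G g l.
Proof.
move=> Gloc Gcov.
have /choice [g gP] := fun n => select_join_size n G Gloc Gcov.
have [h hP] := le_star_bound g.
by exists h => l lX; apply: selects_le_star (hP (size l)) _; exact: gP.
Qed.

End selection.

(** * Cylinders in the Cantor space *)

Local Notation cantor := (prod_topology (fun _ : nat => bool)).

Lemma nbhs_cylinder (f : cantor) (A : set cantor) :
  nbhs f A <-> exists m, agree m f `<=` A.
Proof.
split=> [fA|[m mA]].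
  pose F := filter_from setT (fun m => agree m f : set cantor).
  have FF : Filter F.
    apply: filter_from_filter; first by exists 0.
    move=> m n _ _; exists (maxn m n) => // g fg.
    by split=> i im; apply: fg; rewrite leq_max im ?orbT.
  have Ff : F --> f.
    apply/cvg_sup => i.
    have iT : (fun g : cantor => g i) @` setT = setT.
      by apply/seteqP; split=> // b _; exists (fun=> b).
    apply/cvg_image => //; apply/discrete_cvg; first exact: filter_image.
    exists [set h | h i = f i]; first by exists i.+1 => // g /(_ i (ltnSn i)) ->.
    by apply/seteqP; split=> [_ [h hi <-]|_ ->] //=; exists f.
  by have [m _ mA] := Ff _ fA; exists m.
apply: filterS mA _; elim: m => [|m IH]; first exact: filterS filterT.
have fm : nbhs f ((fun g : cantor => g m) @^-1` [set f m]).
  exact: (@proj_continuous nat (fun=> bool) m f) (discrete_set1 _).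
apply: filterS (filterI IH fm) => g [fg /= gm] i.
by rewrite ltnS leq_eqVlt => /predU1P[->|/fg].
Qed.

(** Otherwise the complements of finite unions of the cylinders generate a proper
filter; its cluster points lie outside all cylinders. *)
Lemma cantor_cylinder_cover (m : (nat -> bool) -> nat) :
  exists s : seq (nat -> bool), forall f, exists2 h, h \in s & agree (m h) h f.
Proof.
have cptT : compact [set: cantor].
  have := @tychonoff _ (fun _ : nat => bool) _ (fun=> bool_compact).
  by congr (compact _); rewrite eqEsubset.
apply: contrapT => /forallNP ns.
pose B (s : seq (nat -> bool)) : set cantor :=
  [set f | forall h, h \in s -> ~ agree (m h) h f].
have FB : ProperFilter (filter_from setT B).
  apply: filter_from_proper => [|s _]; last first.
    apply: contrapT => B0; apply: (ns s) => f; apply: contrapT => nf.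
    by apply: B0; exists f => h hs hf; apply: nf; exists h.
  apply: filter_from_filter; first by exists [::].
  move=> s t _ _; exists (s ++ t) => // f Bf.
  by split=> h hs; apply: Bf; rewrite mem_cat hs ?orbT.
have [|f [_ fcl]] := cptT _ FB; first exact: filterT.
have [||g [gB fg]] := fcl (B [:: f]) (agree (m f) f).
- by exists [:: f].
- by apply/nbhs_cylinder; exists (m f).
by apply: (gB f) => //; exact: mem_head.
Qed.

Section coordinates.
Variable F : set (set nat).

Lemma filter_space_open (O : set (filter_space F)) (Y : filter_space F) :
  open O -> O Y -> exists m, forall Z : filter_space F,
    (forall i, i < m -> val Y i <-> val Z i) -> O Z.
Proof.
move=> [B [C Copen <-] <-] /= YC.
have /nbhs_cylinder [m mC] : nbhs (charfun (val Y) : cantor) C.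
  exact: open_nbhs_nbhs.
exists m => Z YZ; apply: mC => i /YZ YZi.
by rewrite /charfun; apply/idP/idP => /set_mem/YZi/mem_set.
Qed.

Lemma filter_space_open_coord n : open [set Y : filter_space F | val Y n].
Proof.
exists [set A : powerset_space nat | A n] => //.
exists (@^~ n @^-1` [set true]).
  rewrite openE => f /= fn; apply/nbhs_cylinder; exists n.+1 => g fg /=.
  by rewrite -(fg n).
by apply/seteqP; split=> A /=; rewrite /charfun; [move/set_mem|move/mem_set].
Qed.
End coordinates.

(** * The filter *)

Section dual_filter.
Variables (U : set_system nat) (X : set (nat -> bool)).
Hypothesis UF : ProperFilter U.
Hypothesis Uoo : \oo `<=` U.
Hypothesis Xfin : forall z N, (forall j, N <= j -> ~~ z j) -> X z.
Hypothesis XU : forall z, X z -> U [set n | ~~ z n].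

(** The filter dual to the ideal generated by [X]. *)
Definition dual_filter : set (set nat) :=
  [set Y | exists2 l, words X l & [set n | ~~ join l n] `<=` Y].

Lemma dual_filter_sub : dual_filter `<=` U.
Proof.
move=> Y [l lX lY]; apply: filterS lY _.
elim: l lX => [|z l IH] lX; first exact: filterS filterT.
have Uz : U [set n | ~~ z n] by apply/XU/set_mem/lX/mem_head.
have Ul : U [set n | ~~ join l n].
  by apply: IH => y yl; apply: lX; rewrite in_cons yl orbT.
by apply: filterS (filterI Uz Ul) => n [/= zn ln]; rewrite /join /= negb_or zn.
Qed.

Lemma dual_filter_next Y k : dual_filter Y -> exists2 n, k <= n & Y n.
Proof.
move=> /dual_filter_sub UY.
have Uk : U [set n | k <= n] by apply: Uoo; exists k.
by have [n [Yn kn]] := @filter_ex _ U _ _ (filterI UY Uk); exists n.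
Qed.

Lemma dual_filter_compl z : X z -> dual_filter [set n | ~~ z n].
Proof.
move=> Xz; exists [:: z] => [y|n /=]; last by rewrite /join /= orbF.
by rewrite mem_seq1 => /eqP->; exact: mem_set.
Qed.

Lemma dual_filter_filter : is_filter dual_filter.
Proof.
split.
  apply: Build_ProperFilter_ex.
    by move=> Y /(dual_filter_next _ 0)[n _ Yn]; exists n.
  split=> [|Y Z [l lX lY] [m mX mZ]|Y Z YZ [l lX lY]].
  - by exists [::].
  - exists (l ++ m) => [z|n /=]; first by rewrite mem_cat => /orP[/lX|/mX].
    rewrite /join has_cat negb_or => /andP[ln mn].
    by split; [exact: lY|exact: mZ].
  - by exists l => //; exact: subset_trans YZ.
move=> A /finite_seqP [s sA].
have As n : ~~ (n \in s) -> A n.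
  move=> ns; apply: contrapT => nA; move: ns.
  by have : (~` A) n by []; rewrite sA /= => ->.
have Xs : X (fun n => n \in s).
  apply: (Xfin _ (\max_(i <- s) i).+1) => j sj; apply/negP => js.
  by have := leq_bigmax_seq j (F := id) js isT; lia.
have [l lX lY] := dual_filter_compl _ Xs; exists l => //.
by apply: subset_trans lY _ => n /As.
Qed.

Hypothesis Xgap : forall g, small [set z | X z /\ ~ U (gap g z)].

Let F := dual_filter.

(** The members of the filter that contain the complement of [z] form a compact
set, so finitely many sets of a cover suffice for them, and they suffice for all
[z'] that agree with [z] up to some [m]. [select_join] then picks finitely many
values of [m] at each stage, and only finitely many traces on [m] exist. *)
Lemma dual_filter_menger : menger (filter_space F).
Proof.
move=> C Cc.
pose covers k (V : set (set (filter_space F))) m z :=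
  [/\ V `<=` C k, finite_set V &
      forall z' (Y : filter_space F), agree m z z' ->
        [set n | ~~ z' n] `<=` val Y -> (\bigcup_(O in V) O) Y].
pose G k m z := exists V, covers k V m z.
have Gloc : local G.
  move=> k m z z' zz' [V [VC Vf Vc]]; exists V; split=> // w Y z'w.
  by apply: Vc => i im; rewrite zz' // z'w.
have Gcov k l : words X l -> exists m, G k m (join l).
  move=> lX; set z := join l.
  (* [f] ranges over the Cantor space and [Y f] over the supersets of ~z *)
  have zF f : F [set n | ~~ z n || f n] by exists l => // n /= ->.
  pose Y f : filter_space F := SigSub (mem_set (zF f)).
  have /choice [Om OmP] : forall f, exists p : set (filter_space F) * nat,
      C k p.1 /\
      forall Z, (forall i, i < p.2 -> val (Y f) i <-> val Z i) -> p.1 Z.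
    move=> f; have : (\bigcup_(O in C k) O) (Y f) by rewrite (Cc k).2.
    move=> [O CO OY]; have [m mO] := filter_space_open _ _ _ ((Cc k).1 _ CO) OY.
    by exists (O, m).
  have [s sP] := cantor_cylinder_cover (fun f => (Om f).2).
  exists (\max_(f <- s) (Om f).2), [set (Om f).1 | f in [set` s]]; split.
  - by move=> _ [f _ <-]; have [] := OmP f.
  - by apply: finite_image; exact: finite_seq.
  - move=> z' Z zz' z'Z; have [f fs fZ] := sP (fun n => n \in val Z).
    exists (Om f).1; first by exists f.
    apply: (OmP f).2 => i im.
    have im' : i < \max_(f <- s) (Om f).2.
      apply: leq_trans im _.
      exact: (leq_bigmax_seq f (F := fun f => (Om f).2)).
    rewrite /= (fZ i im); split=> [/orP[zi|/set_mem//]|/mem_set ->]; last first.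
      by rewrite orbT.
    by apply: z'Z; rewrite /= -zz'.
have [g gP] := select_join U X UF Uoo Xfin Xgap _ Gloc Gcov.
have /choice [V VP] : forall k, exists V, [/\ V `<=` C k, finite_set V &
    forall m z, m <= g k -> G k m z ->
      forall Y : filter_space F, [set n | ~~ z n] `<=` val Y ->
      (\bigcup_(O in V) O) Y].
  move=> k.
  pose ext (i : {m : 'I_(g k).+1 & m.-tuple bool}) := nth false (tagged i).
  have /choice [W WP] : forall i : {m : 'I_(g k).+1 & m.-tuple bool},
      exists V, [/\ V `<=` C k, finite_set V &
      G k (tag i) (ext i) -> covers k V (tag i) (ext i)].
    move=> i; have [[V Vc]|nG] := pselect (G k (tag i) (ext i)).
      by exists V; have [] := Vc.
    by exists set0; split=> //.
  exists (\bigcup_i W i); split.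
  - by move=> O [i _]; have [+ _ _] := WP i; exact.
  - by apply: bigcup_finite => [|i _]; [exact: finite_finset|have [] := WP i].
  move=> m z mg Gz Y zY; rewrite -ltnS in mg.
  pose i : {m : 'I_(g k).+1 & m.-tuple bool} :=
    existT _ (Ordinal mg) [tuple z j | j < m].
  have zi : agree m z (ext i).
    move=> j jm; rewrite /ext (nth_map (Ordinal jm)) ?size_enum_ord //.
    by rewrite nth_enum_ord.
  have [_ _ /(_ (Gloc _ _ _ _ zi Gz)) [_ _ WiP]] := WP i.
  have [|O WO OY] := WiP z Y _ zY; first by move=> j jm; rewrite zi.
  by exists O => //; exists i.
exists V; split=> [k|]; first by have [] := VP k.
apply/seteqP; split=> // Y _; have /set_mem [l lX lY] := valP Y.
have [k [m [_ mg Gm]]] := gP l lX 0.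
have [_ _ Vk] := VP k.
by exists k => //; exact: Vk Gm Y lY.
Qed.

Hypothesis Xfull : forall g,
  exists2 z, X z & forall K, exists2 n, K <= n & forall j, n <= j <= g n -> z j.

(** The [k]-th cover sorts the members [Y] of the filter by their first element
after [k]. A selection as in the definition of Hurewicz spaces would bound these
next-element functions, which the complements of the [z] in [Xfull] forbid. *)
Lemma dual_filter_not_hurewicz : ~ hurewicz (filter_space F).
Proof.
move=> hF.
pose O k j := [set Y : filter_space F | exists2 n, k <= n < j & val Y n].
pose C k := range (O k).
have [k|V [VC VP]] := hF C.
  split=> [_ [j _ <-]|].
    have -> : O k j = \bigcup_(n in [set n | k <= n < j])
        [set Y : filter_space F | val Y n].
      by apply/seteqP; split=> Y [n]; exists n.
    by apply: bigcup_open => n _; exact: filter_space_open_coord.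
  apply/seteqP; split=> // Y _.
  have [n kn Yn] := dual_filter_next _ k (set_mem (valP Y)).
  by exists (O k n.+1); [exists n.+1|exists n => //; rewrite kn ltnSn].
have /choice [g gP] : forall k, exists j, forall P, V k P -> P `<=` O k j.
  move=> k; have [VCk /finite_seqP [s sV]] := VC k.
  have /choice [c cP] : forall P, exists j, V k P -> P = O k j.
    move=> P; have [/VCk [j _ <-]|nV] := pselect (V k P); first by exists j.
    by exists 0.
  exists (\max_(P <- s) c P) => P VP' Y.
  rewrite (cP P VP') => -[n /andP[kn nc] Yn]; exists n => //.
  rewrite kn (leq_trans nc) //; apply: (leq_bigmax_seq P) => //.
  by move: VP'; rewrite sV.
have [z Xz zP] := Xfull g.
pose Y : filter_space F := SigSub (mem_set (dual_filter_compl z Xz)).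
have [N _ NP] := VP Y; have [n Nn zn] := zP N.
have [P VnP /(gP _ _ VnP)[j /andP[nj jg]]] := NP n Nn.
by rewrite /= zn // nj ltnW.
Qed.

(** Next-element functions of the members of a base bound those of all members
of the filter, and the latter are unbounded by [Xfull]. *)
Lemma dual_filter_base_not_small (B : set (set nat)) : is_base F B -> ~ small B.
Proof.
move=> [BF Bb] sB.
have /choice [p pP] : forall Y : set nat, exists p : nat -> nat,
    F Y -> forall k, k <= p k /\ Y (p k).
  move=> Y; have [FY|nY] := pselect (F Y); last by exists id.
  have /choice [p pP] : forall k, exists n, k <= n /\ Y n.
    by move=> k; have [n kn Yn] := dual_filter_next _ k FY; exists n.
  by exists p.
have [g gP] := sB p; have [z Xz zP] := Xfull g.
have [Y BY Yz] := Bb _ (dual_filter_compl z Xz).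
have /le_starP [N pg] := gP Y BY; have [n Nn zn] := zP N.
have [np /Yz] := pP Y (BF _ BY) n.
by rewrite /= zn // np pg.
Qed.

End dual_filter.

(** A word [s] over [I] codes the complement of the union of the [x a], [a] in
[s], and of the numbers below [size s]. Repeating a letter makes the word as long as
needed, so the words alone give a base. *)
Lemma dual_filter_base_le (T : pointedType) (I : set T) (x : T -> nat -> bool) :
  infinite_set I ->
  exists2 B, is_base (dual_filter [set z | (exists2 a, I a & z = x a) \/
    exists N, forall j, N <= j -> ~~ z j]) B & B #<= I.
Proof.
set X := [set z | _] => Iinf; have [a0 Ia0] := infinite_setN0 Iinf.
pose Y s := [set n | size s <= n /\ forall a, a \in s -> ~~ x a n].
exists (Y @` words I); last first.
  exact: card_le_trans (card_image_le _ _) (words_card_le _ _ Iinf).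
split=> [_ [s sI <-]|A [l lX lA]].
  pose z0 n := n < size s.
  exists (z0 :: [seq x a | a <- s]) => [z|n /=].
    rewrite in_cons => /predU1P[->|/mapP[a /sI/set_mem Ia ->]]; apply: mem_set.
      by right; exists (size s) => j; rewrite /z0 -leqNgt.
    by left; exists a.
  rewrite /join /= negb_or /z0 -leqNgt has_map => /andP[sn /hasPn nx].
  by split.
suff [s sI sl] : exists2 s, words I s & Y s `<=` [set n | ~~ join l n].
  by exists (Y s); [exists s|exact: subset_trans lA].
elim: l lX {lA} => [|z l IH] lX; first by exists [::] => // n.
have [|s sI sl] := IH; first by move=> y yl; apply: lX; rewrite in_cons yl orbT.
have /set_mem [[a Ia za]|[N zN]] := lX z (mem_head _ _).
  exists (a :: s) => [b|n [/= sn nx]].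
    by rewrite in_cons => /predU1P[->|/sI//]; exact: mem_set.
  rewrite /join /= negb_or za nx ?mem_head //.
  apply: sl; split; first exact: ltnW.
  by move=> b bs; apply: nx; rewrite in_cons bs orbT.
exists (nseq N a0 ++ s) => [b|n [/= sn nx]].
  by rewrite mem_cat => /orP[/nseqP[-> _]|/sI//]; exact: mem_set.
rewrite size_cat size_nseq in sn.
rewrite /join /= negb_or zN; last exact: leq_trans (leq_addr _ _) sn.
apply: sl; split; first exact: leq_trans (leq_addl _ _) sn.
by move=> b bs; apply: nx; rewrite mem_cat bs orbT.
Qed.

Theorem proposition3p6 :
  bfrak #= dfrak ->
  exists (D : Type) (F : set (set D)),
    [/\ [set: D] #= [set: nat], is_filter F, menger (filter_space F),
        character F #= dfrak & ~ hurewicz (filter_space F)].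
Proof.
move=> bd.
have [I [b [nsI Id Ib]]] := scale_of_eq bd.
have [U [UU Uoo]] := @ultraFilterLemma _ \oo _.
have /choice [x xP] := fun a => sparse_set U (b a) UU.
pose X := [set z | (exists2 a, I a & z = x a) \/
  exists N, forall j, N <= j -> ~~ z j].
have Xfin z N : (forall j, N <= j -> ~~ z j) -> X z by move=> zN; right; exists N.
have Ufin z N g : (forall j, N <= j -> ~~ z j) -> U (gap g z).
  by move=> zN; apply: Uoo; exists N => // n /= Nn j /andP[nj _]; apply: zN; lia.
have XU z : X z -> U [set n | ~~ z n].
  case=> [[a Ia ->]|[N zN]].
    have [xU _] := xP a; apply: filterS xU => n /= /(_ n); apply.
    by rewrite leqnn leq_maxl.
  by apply: filterS (Ufin z N id zN) => n /= /(_ n); apply; rewrite leqnn.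
have Xgap g : small [set z | X z /\ ~ U (gap g z)].
  apply: small_sub (small_image _ _ x _ (Ib g)) => z [[[a Ia ->]|[N zN]] nU].
    exists a => //; split=> // /le_starP [N gb]; apply: nU.
    have UN : U [set n | N <= n] by apply: Uoo; exists N.
    have [xU _] := xP a.
    apply: filterS (filterI xU UN) => n [/= xn Nn] j /andP[nj jn].
    by apply: xn; have := gb n Nn; lia.
  by case: nU; exact: Ufin zN.
have Xfull g : exists2 z, X z &
    forall K, exists2 n, K <= n & forall j, n <= j <= g n -> z j.
  have [a Ia ga] : exists2 a, I a & le_star g (b a).
    apply: contrapT => nI; apply: nsI; apply: small_sub (Ib g) => a Ia.
    by split=> // ga; apply: nI; exists a.
  have /le_starP [N gb] := ga.
  exists (x a) => [|K]; first by left; exists a.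
  have [_ /(_ (K + N)) [n Kn xn]] := xP a; exists n; first by lia.
  by move=> j jn; apply: xn; have := gb n; lia.
have Iinf : infinite_set I.
  by move=> /finite_set_countable/countable_small.
exists nat, (dual_filter X); split.
- exact: card_eqxx.
- exact: (dual_filter_filter U).
- exact: (dual_filter_menger U).
- have [cb cmin] := least_cardP (ex_intro _ _ (is_base_refl (dual_filter X))).
  apply/card_eqPle; split.
    have [B Bb BI] := dual_filter_base_le _ I x Iinf.
    exact: card_le_trans (cmin _ Bb) (card_le_trans BI Id).
  rewrite -(card_le_eql bd); apply: bfrak_le.
  exact: (dual_filter_base_not_small U) cb.
- exact: (dual_filter_not_hurewicz U).
Qed.
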